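(* Let $(X,q)$ be an asymmetric normed space. If the closed ball $B_q[0,1]=\{x\in X:q(x)\le 1\}$ is a closed set in the topology induced by $q$, then $X$ (with this topology) is $T_{3\frac12}$ and $T_2$. Hence, $X$ is completely regular.
   Context: An asymmetric norm on a real vector space $X$ is a function $q:X\to[0,\infty)$ such that $q(ax)=aq(x)$ for all $a\ge 0$, $q(x+y)\le q(x)+q(y)$, and $q(x)=q(-x)=0$ implies $x=0$. The pair $(X,q)$ is an asymmetric normed space; its topology is generated by the open balls $B_q(x,\epsilon)=\{y\in X: q(y-x)<\epsilon\}$. Convention: a space is $T_{3\frac12}$ if for every closed set $F$ and every point $x\notin F$ there is a continuous function $f:X\to[0,1]$ with $f(x)=0$ and $f(F)\subseteq\{1\}$ (no $T_1$ assumption is included). A completely regular space is a space satisfying both $T_1$ and $T_{3\frac12}$. *)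

(* Defs.v *)
From HB Require Import structures.
From mathcomp Require Import all_boot all_order all_algebra.
From mathcomp Require Import all_classical all_reals all_analysis.

Set Implicit Arguments.
Unset Strict Implicit.
Unset Printing Implicit Defensive.

Import Order.TTheory GRing.Theory Num.Theory.
Import numFieldNormedType.Exports.

Local Open Scope classical_set_scope.
Local Open Scope ring_scope.

Record is_asym_norm (R : realType) (X : lmodType R) (q : X -> R) : Prop := {
  asym_norm_ge0 : forall x, 0 <= q x;
  asym_normZ : forall a x, 0 <= a -> q (a *: x) = a * q x;
  asym_normD : forall x y, q (x + y) <= q x + q y;
  asym_norm0_eq0 : forall x, q x = 0 -> q (- x) = 0 -> x = 0
}.

Definition asym_ball (R : realType) (X : lmodType R) (q : X -> R)
    (x : X) (e : R) : set X :=
  [set y | q (y - x) < e].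

(* Alias of X: the phantom argument q keys the topology, which does not
   interfere with any topology X may otherwise carry. *)
Definition asym_space (R : realType) (X : lmodType R) (q : X -> R) : Type := X.

Section asym_topology.
Variables (R : realType) (X : lmodType R) (q : X -> R).

Definition asym_balls : set_system X :=
  [set B | exists x e, 0 < e /\ B = asym_ball q x e].

HB.instance Definition _ := Choice.on (asym_space q).
(* The balls are only declared as a subbase, so that q need not be an
   asymmetric norm here; when it is one, they form a base. *)
HB.instance Definition _ :=
  isSubBaseTopological.Build (asym_space q) asym_balls id.

End asym_topology.

(* No T1 assumption. The library's completely_regular_space is phrased with
   uniform separators instead of continuous functions. *)
Definition T35_space (R : realType) (T : topologicalType) : Prop :=
  forall (F : set T) (x : T), closed F -> ~ F x ->
    exists f : T -> R, [/\ continuous f, forall y, 0 <= f y <= 1,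
      f x = 0 & f @` F `<=` [set 1]].

Definition completely_regular (R : realType) (T : topologicalType) : Prop :=
  accessible_space T /\ T35_space R T.

(* Main.v *)
(** Upper semicontinuity of [q] is automatic, since [q z <= q y + q (z - y)].
    Closedness of the unit ball gives, by scaling and translation, lower
    semicontinuity. Hence every [y |-> q (y - x)] is continuous; these functions
    separate points, and [y |-> min (q (y - x) / e) 1] separates [x] from the
    complement of its [e]-ball. *)
Require Import Defs.
From mathcomp Require Import all_boot all_order all_algebra.
From mathcomp Require Import all_classical all_reals all_analysis.
From mathcomp Require Import lra.

Set Implicit Arguments.
Unset Strict Implicit.
Unset Printing Implicit Defensive.

Import Order.TTheory GRing.Theory Num.Theory.
Import numFieldNormedType.Exports.

Local Open Scope classical_set_scope.
Local Open Scope ring_scope.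

(** Reduces separation in [T] to separation in [U]: neighbourhoods of [f x] and [f y] pull back to
    neighbourhoods of [x] and [y], which meet. *)
Lemma continuous_cluster_eq (T U : topologicalType) (f : T -> U) (x y : T) :
  hausdorff_space U -> continuous f -> cluster (nbhs x) y -> f x = f y.
Proof.
move=> hU cf xy; apply: hU => A B /cf fA /cf fB.
by have [z []] := xy _ _ fA fB; exists (f z).
Qed.

Section asym_norm.
Variables (R : realType) (X : lmodType R) (q : X -> R).
Hypothesis hq : is_asym_norm q.

Lemma asym_norm0 : q 0 = 0.
Proof. by rewrite -(scale0r 0) (asym_normZ hq) ?mul0r. Qed.

Lemma asym_norm_le_dist x y z : q (z - x) <= q (y - x) + q (z - y).
Proof.
have -> : z - x = (y - x) + (z - y) by rewrite [RHS]addrC addrA subrK.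
exact: (asym_normD hq).
Qed.

Lemma asym_ball_open x e : open (asym_ball q x e : set (asym_space q)).
Proof.
have [e0|e0] := ltP 0 e; last first.
  suff -> : asym_ball q x e = set0 by exact: open0.
  apply/seteqP; split=> // y /=.
  by move=> /lt_le_trans/(_ e0); rewrite ltNge (asym_norm_ge0 hq).
exists [set asym_ball q x e : set (asym_space q)]; last by rewrite bigcup_set1.
by move=> _ ->; apply: finI_from1; exists x, e.
Qed.

(** Makes a ball a neighbourhood of each of its points [y], where the smaller radius is positive. *)
Lemma asym_ball_shift x y e : asym_ball q y (e - q (y - x)) `<=` asym_ball q x e.
Proof.
by move=> z; rewrite /asym_ball /= => yz; have := asym_norm_le_dist x y z; lra.
Qed.

(** Upgrades the subbase of balls to a base: each ball containing [x] includes one centred at [x],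
    and finitely many concentric balls intersect in the smallest. *)
Lemma nbhs_asymE (x : asym_space q) (U : set (asym_space q)) :
  nbhs x U <-> exists2 e : R, 0 < e & asym_ball q x e `<=` U.
Proof.
split=> [|[e e0 eU]]; last first.
  rewrite nbhsE; exists (asym_ball q x e) => //; split; first exact: asym_ball_open.
  by rewrite /asym_ball /= subrr asym_norm0.
rewrite nbhsE => -[B [[D DI <-] [A DA Ax]] BU].
(* Once these sets are known to form a filter, finite intersections of subbasic balls reduce to a
   single ball. *)
pose F : set_system X := filter_from [set e : R | 0 < e] (asym_ball q x).
have FF : Filter F.
  apply: filter_from_filter; first by exists 1 => /=.
  move=> e d /= e0 d0; exists (Num.min e d) => /=; first by rewrite lt_min e0.
  by move=> y; rewrite /asym_ball /= lt_min => /andP[].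
suff [e e0 eA] : F A by exists e => // y /eA Ay; apply: BU; exists A.
have [E EB EA] := DI _ DA; rewrite -EA; apply: filter_bigI => C CE.
have /set_mem[y [d [d0 Cd]]] := EB _ CE.
have : C x by move: Ax; rewrite -EA; apply.
rewrite /= Cd => xd; exists (d - q (x - y)); last exact: asym_ball_shift.
by rewrite /= subr_gt0.
Qed.

Hypothesis hclosed : closed [set x : asym_space q | q x <= 1].

(** Since [r^-1 *: x] lies outside the closed unit ball, so does a whole [e]-ball around it; scaling
    back by [r] turns the radius into [e * r]. *)
Lemma asym_norm_lsc (x : X) (r : R) : 0 < r -> r < q x ->
  exists2 e : R, 0 < e & forall z, q (z - x) < e -> r < q z.
Proof.
move=> r0 rx; have ri : 0 <= r^-1 by rewrite invr_ge0 ltW.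
have : nbhs (r^-1 *: x : asym_space q) (~` [set x : asym_space q | q x <= 1]).
  apply: open_nbhs_nbhs; split; first exact: closed_openC.
  by apply/negP; rewrite -ltNge (asym_normZ hq)// mulrC ltr_pdivlMr// mul1r.
move=> /nbhs_asymE[e e0 eP]; exists (e * r); first exact: mulr_gt0.
move=> z zx; have := eP (r^-1 *: z); rewrite /asym_ball /= -scalerBr.
rewrite !(asym_normZ hq)// ![r^-1 * _]mulrC ltr_pdivrMr// => /(_ zx) /negP.
by rewrite -ltNge ltr_pdivlMr// mul1r.
Qed.

Lemma asym_dist_continuous (x : X) :
  continuous (fun y : asym_space q => q ((y : X) - x)).
Proof.
move=> y; apply/(cvgrPdist_le (FF := nbhs_filter y)) => e e0; apply/nbhs_asymE.
have [d d0 dP] : exists2 d : R, 0 < d &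
    forall z : X, q (z - y) < d -> q ((y : X) - x) - e <= q (z - x).
  (* Scaling needs a positive level; at a level at most 0 the bound is just nonnegativity of [q]. *)
  have [le0|gt0] := leP (q ((y : X) - x) - e) 0.
    by exists 1 => // z _; apply: (le_trans le0); exact: (asym_norm_ge0 hq).
  have [|d d0 dP] := @asym_norm_lsc ((y : X) - x) _ gt0; first by lra.
  by exists d => // z zy; apply/ltW/dP; rewrite opprB addrA subrK.
(* Radius [d] gives the lower estimate, radius [e] the upper one through the triangle inequality. *)
exists (Num.min d e); first by rewrite lt_min d0.
move=> z; rewrite /asym_ball /= lt_min => /andP[/dP zd ze].
have := asym_norm_le_dist x y z.
by rewrite ler_distlC => yz; apply/andP; split; lra.
Qed.

(** Inseparable points have the same distance from every [z]; taking [z] to be [x] and then [y]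
    makes both [q (y - x)] and [q (x - y)] vanish. *)
Lemma asym_hausdorff : hausdorff_space (asym_space q).
Proof.
move=> x y xy.
have distxy z := continuous_cluster_eq (@Rhausdorff R) (@asym_dist_continuous z) xy.
have /= := distxy x; rewrite subrr asym_norm0 => yx0.
have /= := distxy y; rewrite subrr asym_norm0 => xy0.
by apply/subr0_eq/(asym_norm0_eq0 hq); rewrite ?opprB.
Qed.

Lemma asym_T35 : T35_space R (asym_space q).
Proof.
move=> F x Fcl Fx.
have : nbhs x (~` F) by apply: open_nbhs_nbhs; split=> //; exact: closed_openC.
move=> /nbhs_asymE[e e0 eF].
exists (fun y : asym_space q => Num.min (q ((y : X) - x) / e) 1); split.
- move=> y; apply: (@continuous_min R (asym_space q)
    (fun z => q ((z : X) - x) / e) (fun=> 1) y).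
    by apply: cvgMr_tmp; [exact: nbhs_filter|exact: asym_dist_continuous].
  exact: cst_continuous.
- move=> y; rewrite le_min ler01 ge_min lexx orbT !andbT.
  by rewrite divr_ge0 ?(asym_norm_ge0 hq)// ltW.
- by rewrite subrr asym_norm0 mul0r min_l.
(* The [e]-ball around [x] misses [F], so the quotient is at least 1 on [F]. *)
- move=> _ [y Fy <-] /=; apply: min_r.
  rewrite ler_pdivlMr// mul1r leNgt; apply/negP => yx.
  exact: eF yx Fy.
Qed.

End asym_norm.

Theorem corollary6p3 (R : realType) (X : lmodType R) (q : X -> R)
    (hq : is_asym_norm q)
    (hclosed : closed [set x : asym_space q | q x <= 1]) :
  (T35_space R (asym_space q) /\ hausdorff_space (asym_space q)) /\
  completely_regular R (asym_space q).
Proof.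
have T35 := asym_T35 hq hclosed; have T2 := asym_hausdorff hq hclosed.
by split; split=> //; exact: hausdorff_accessible.
Qed.
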